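(* For every $\epsilon>0$ there is an $N$ such that for all (even) $m\geq N$, words $w$ of reduced length $m$ generically satisfy $$\operatorname{scl}(w)\in\Big[\frac m4-1,\ \frac m4-1+\epsilon\Big].$$
   Context: For a group $G$ and $g\in[G,G]$, $\operatorname{cl}(g)$ is the least number of commutators in $G$ whose product is $g$, and the stable commutator length is $\operatorname{scl}(g)=\lim_{k\to\infty}\operatorname{cl}(g^k)/k$. $\mathbb{Z}^\infty$ is the free abelian group on countably many generators; the generators of the left factor of $\mathbb{Z}^\infty*\mathbb{Z}^\infty$ are $a_1,a_2,\dots$, those of the right factor $b_1,b_2,\dots$. For $n\ge1$ let $V=\{z\in\mathbb{Z}^n:\sum_j z_j=0\}$ (a $\mathbb{Z}$-module of rank $n-1$), and let $M_n$ be the set of all finitely supported sequences $z=(z^{(1)},z^{(2)},\dots)$ of vectors $z^{(i)}\in V$ such that for every $j\in\{1,\dots,n\}$ there is an $i$ with $z^{(i)}_j\neq0$. For $(x,y)\in M_n\times M_n$ put $$\phi(x,y)=\big(a_1^{x^{(1)}_1}a_2^{x^{(2)}_1}\cdots\big)\big(b_1^{y^{(1)}_1}b_2^{y^{(2)}_1}\cdots\big)\cdots\big(a_1^{x^{(1)}_n}a_2^{x^{(2)}_n}\cdots\big)\big(b_1^{y^{(1)}_n}b_2^{y^{(2)}_n}\cdots\big).$$ The map $\phi$ is a bijection from $M_n\times M_n$ onto the words of reduced length $2n$, i.e. elements of the commutator subgroup of $\mathbb{Z}^\infty*\mathbb{Z}^\infty$ of the form $u_1v_1\cdots u_nv_n$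 with the $u_i$ nontrivial in the left factor and the $v_i$ nontrivial in the right factor. Genericity: let $P$ be a property of words in the commutator subgroup of $\mathbb{Z}^\infty*\mathbb{Z}^\infty$. Words of reduced length $m=2n$ generically satisfy $P$ if there are finitely many submodules $W_1,\dots,W_l$ of $V$, each of rank at most $n-2$, such that for all $(x,y)\in M_n\times M_n$ the following holds: whenever not all $x^{(i)}$ lie in $\bigcup_k W_k$ and not all $y^{(i)}$ lie in $\bigcup_kW_k$, the property $P(\phi(x,y))$ holds. *)

(* Defs.v *)
From HB Require Import structures.
From mathcomp Require Import all_boot all_order all_algebra.
From mathcomp Require Import finmap generic_quotient.
From mathcomp Require Import boolp classical_sets reals topology normedtype.
From mathcomp Require Import sequences.
From mathcomp.multinomials Require Import freeg.

Set Implicit Arguments.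
Unset Strict Implicit.
Unset Printing Implicit Defensive.

Import Order.TTheory GRing.Theory Num.Theory.
Import numFieldNormedType.Exports.

Local Open Scope ring_scope.
Local Open Scope quotient_scope.

Section FreeProduct.
Variables A B : zmodType.

Local Notation word := (seq (A + B)).

(* The least congruence for concatenation that identifies the zeros with the
   empty word and adjacent letters of the same factor with their sum; the free
   product is the quotient, with A and B written additively. *)
Inductive fprod_eq : word -> word -> Prop :=
| fprod_eq_refl s : fprod_eq s s
| fprod_eq_sym s t : fprod_eq s t -> fprod_eq t s
| fprod_eq_trans s t u : fprod_eq s t -> fprod_eq t u -> fprod_eq s u
| fprod_eq_cat s s' t t' :
    fprod_eq s s' -> fprod_eq t t' -> fprod_eq (s ++ t) (s' ++ t')
| fprod_eq_l0 : fprod_eq [:: inl 0] [::]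
| fprod_eq_r0 : fprod_eq [:: inr 0] [::]
| fprod_eq_lD a a' : fprod_eq [:: inl a; inl a'] [:: inl (a + a')]
| fprod_eq_rD b b' : fprod_eq [:: inr b; inr b'] [:: inr (b + b')].

Definition fprod_rel : rel word := fun s t => `[< fprod_eq s t >].

Lemma fprod_rel_refl : reflexive fprod_rel.
Proof. by move=> s; apply/asboolP; exact: fprod_eq_refl. Qed.

Lemma fprod_rel_sym : symmetric fprod_rel.
Proof.
by move=> s t; apply/asboolP/asboolP => ?; exact: fprod_eq_sym.
Qed.

Lemma fprod_rel_trans : transitive fprod_rel.
Proof.
by move=> t s u /asboolP st /asboolP tu; apply/asboolP; exact: fprod_eq_trans tu.
Qed.

Definition fprod_equiv :=
  EquivRel fprod_rel fprod_rel_refl fprod_rel_sym fprod_rel_trans.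

Definition free_product := {eq_quot fprod_equiv}.

HB.instance Definition _ := Choice.on free_product.
HB.instance Definition _ := EqQuotient.on free_product.

Definition fprod_pi (s : word) : free_product := \pi_free_product s.

Lemma fprod_piP s t : fprod_pi s = fprod_pi t <-> fprod_eq s t.
Proof.
split=> [/eqmodP/asboolP //|st].
by apply/eqmodP/asboolP.
Qed.

Lemma fprod_pi_repr (x : free_product) : fprod_pi (repr x) = x.
Proof. by rewrite /fprod_pi reprK. Qed.

Lemma fprod_eq_repr s : fprod_eq (repr (fprod_pi s)) s.
Proof. by apply/fprod_piP; rewrite fprod_pi_repr. Qed.

Definition letter_inv (c : A + B) : A + B :=
  match c with inl a => inl (- a) | inr b => inr (- b) end.

Definition word_inv (s : word) : word := rev (map letter_inv s).

Lemma word_inv_cat s t : word_inv (s ++ t) = word_inv t ++ word_inv s.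
Proof. by rewrite /word_inv map_cat rev_cat. Qed.

Lemma word_invK : involutive word_inv.
Proof.
move=> s; rewrite /word_inv map_rev revK -map_comp.
by elim: s => //= -[] a s -> /=; rewrite opprK.
Qed.

Lemma fprod_eq_inv s t : fprod_eq s t -> fprod_eq (word_inv s) (word_inv t).
Proof.
elim=> {s t}.
- by move=> *; exact: fprod_eq_refl.
- by move=> *; exact: fprod_eq_sym.
- by move=> s t u _ st _ tu; exact: fprod_eq_trans tu.
- by move=> s s' t t' _ ? _ ?; rewrite !word_inv_cat; exact: fprod_eq_cat.
- by rewrite /word_inv /= oppr0; exact: fprod_eq_l0.
- by rewrite /word_inv /= oppr0; exact: fprod_eq_r0.
- by move=> a a'; rewrite /word_inv /= opprD addrC; exact: fprod_eq_lD.
- by move=> b b'; rewrite /word_inv /= opprD addrC; exact: fprod_eq_rD.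
Qed.

Lemma fprod_eq_mulV s : fprod_eq (word_inv s ++ s) [::].
Proof.
elim: s => [|c s IHs]; first exact: fprod_eq_refl.
rewrite -cat1s word_inv_cat -catA (catA (word_inv [:: c])).
apply: fprod_eq_trans IHs; apply: fprod_eq_cat; first exact: fprod_eq_refl.
rewrite -[X in fprod_eq _ X]cat0s.
apply: fprod_eq_cat; last exact: fprod_eq_refl.
case: c => [a|b]; rewrite /word_inv /=.
- by apply: fprod_eq_trans (fprod_eq_lD _ _) _; rewrite addNr; exact: fprod_eq_l0.
- by apply: fprod_eq_trans (fprod_eq_rD _ _) _; rewrite addNr; exact: fprod_eq_r0.
Qed.

Definition fprod_mul (x y : free_product) := fprod_pi (repr x ++ repr y).
Definition fprod_inv (x : free_product) := fprod_pi (word_inv (repr x)).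

Lemma fprod_mulE s t : fprod_mul (fprod_pi s) (fprod_pi t) = fprod_pi (s ++ t).
Proof. by apply/fprod_piP/fprod_eq_cat; exact: fprod_eq_repr. Qed.

Lemma fprod_invE s : fprod_inv (fprod_pi s) = fprod_pi (word_inv s).
Proof. by apply/fprod_piP/fprod_eq_inv; exact: fprod_eq_repr. Qed.

Lemma fprod_mulA : associative fprod_mul.
Proof.
move=> x y z; rewrite -[x]fprod_pi_repr -[y]fprod_pi_repr -[z]fprod_pi_repr.
by rewrite !fprod_mulE catA.
Qed.

Lemma fprod_mul1 : left_id (fprod_pi [::]) fprod_mul.
Proof. by move=> x; rewrite -[x]fprod_pi_repr fprod_mulE. Qed.

Lemma fprod_mulr1 : right_id (fprod_pi [::]) fprod_mul.
Proof. by move=> x; rewrite -[x]fprod_pi_repr fprod_mulE cats0. Qed.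

Lemma fprod_mulV : left_inverse (fprod_pi [::]) fprod_inv fprod_mul.
Proof.
move=> x; rewrite -[x]fprod_pi_repr fprod_invE fprod_mulE.
exact/fprod_piP/fprod_eq_mulV.
Qed.

Lemma fprod_mulrV : right_inverse (fprod_pi [::]) fprod_inv fprod_mul.
Proof.
move=> x; rewrite -[x]fprod_pi_repr fprod_invE fprod_mulE.
apply/fprod_piP; rewrite -{1}[repr x]word_invK; exact: fprod_eq_mulV.
Qed.

HB.instance Definition _ := isGroup.Build free_product
  fprod_mulA fprod_mul1 fprod_mulr1 fprod_mulV fprod_mulrV.

Definition fprod_inl (a : A) : free_product := fprod_pi [:: inl a].
Definition fprod_inr (b : B) : free_product := fprod_pi [:: inr b].

End FreeProduct.

Arguments fprod_inl {A B} a.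
Arguments fprod_inr {A B} b.

Section CommutatorLength.
Local Open Scope group_scope.

Definition prod_of_commutators (G : groupType) (k : nat) (g : G) : Prop :=
  exists s : k.-tuple (G * G), g = \prod_(p <- s) [~ p.1, p.2].

(* The value is only meaningful on the commutator subgroup, i.e., when some k
   qualifies; elsewhere it is set to 0. *)
Definition cl (G : groupType) (g : G) : nat :=
  match pselect (exists k, `[< prod_of_commutators k g >]) with
  | left ex_k => ex_minn ex_k
  | right _ => 0
  end.

Definition scl (R : realType) (G : groupType) (g : G) : R :=
  limn (fun k => (cl (g ^+ k))%:R / k%:R : R)%R.

End CommutatorLength.

Notation Zinf := {freeg nat}.
Definition Zinf2 : groupType := free_product Zinf Zinf.

Definition V n : {pred 'rV[int]_n} := [pred z : 'rV[int]_n | \sum_j z 0 j == 0].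
Arguments V n : clear implicits.

Notation finseq n := {fsfun nat -> 'rV[int]_n with 0}.

Definition M n (z : finseq n) : Prop :=
  (forall i, z i \in V n) /\ (forall j : 'I_n, exists i, z i 0 j != 0).

(* The exponents (z^(i)_j)_i of the j-th syllable; << 1 *g i >> is the i-th
   generator, counted from 0, of the additively written group Zinf. *)
Definition syllable n (z : finseq n) (j : 'I_n) : Zinf :=
  \sum_(i <- finsupp z) << z i 0 j *g i >>.

Definition phi n (x y : finseq n) : Zinf2 :=
  (\prod_(j < n) (fprod_inl (syllable x j) *
                  fprod_inr (syllable y j)))%g.

Definition submodule n (W : {pred 'rV[int]_n}) : Prop :=
  zmod_closed W /\ {subset W <= V n}.

(* The family is given by the rows of A. *)
Definition lin_indep n (W : {pred 'rV[int]_n}) k (A : 'M[int]_(k, n)) : Prop :=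
  (forall i, row i A \in W) /\ (forall c : 'rV[int]_k, c *m A = 0 -> c = 0).

Definition has_rank n (W : {pred 'rV[int]_n}) (r : nat) : Prop :=
  (exists A : 'M[int]_(r, n), lin_indep W A) /\
  (forall k (A : 'M[int]_(k, n)), lin_indep W A -> (k <= r)%N).

(* - P is only ever tested on words phi x y, which lie in the commutator
     subgroup since the vectors x i and y i lie in V n.
   - r + 2 <= n rather than r <= n - 2, as the latter truncates for n = 1. *)
Definition generically n (P : Zinf2 -> Prop) : Prop :=
  exists (l : nat) (W : 'I_l -> {pred 'rV[int]_n}),
    (forall k, submodule (W k) /\
               exists2 r, has_rank (W k) r & (r + 2 <= n)%N) /\
    (forall x y : finseq n, M x -> M y ->
       ~ (forall i, exists k, x i \in W k) ->
       ~ (forall i, exists k, y i \in W k) ->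
       P (phi x y)).

(* Main.v *)
Require Import Defs.
From mathcomp Require Import all_boot all_order all_algebra.
From mathcomp Require Import finmap zify lra.
From mathcomp Require Import boolp classical_sets reals topology normedtype.
From mathcomp Require Import sequences.
From mathcomp.multinomials Require Import freeg.

Set Implicit Arguments.
Unset Strict Implicit.
Unset Printing Implicit Defensive.

Import Order.TTheory GRing.Theory Num.Theory.

(** Let n = m / 2 and w = u_1 v_1 ... u_n v_n, so that m / 4 - 1 = (n - 2) / 2.

    Lower bound. An odd function on the letters, with defect at most 1/2 on each
    factor, extends to reduced words by summation. The extension [qmorph] has
    defect at most 1/2 on the whole free product ([qmorph_defect]), since in the
    product of two reduced words inverse letters cancel in pairs and then at
    most one pair of letters merges. Hence it is at most 2k on a product of k
    commutators ([qmorph_pcomm]). If it is at least 1/2 - 1/n on each of the 2n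
    syllables, it is at least k (n - 2) on w^k, whence scl w >= (n - 2) / 2.
    Such a function of one coordinate of the syllables is [sawtooth]; it is
    available as soon as no sum of fewer than n values of this coordinate,
    repetitions allowed, vanishes. Each vanishing sum puts the coordinate
    vector into one of finitely many hyperplanes of V, and these are the
    submodules that genericity excludes ([relation_plane]).

    Upper bound, for all words with zero exponent sums. Write x =_r y if
    x y^-1 is a product of r commutators. The basic move x q y =_1 y q x merges
    three pairs u_i v_i into one, and gives (x y)^k =_(k/2) x^k y^k.
    If n = 2r + 3, then w =_r c c^-1 up to conjugation of the factors, and w^k
    is a product of at most k (r + 1/2) + 2 commutators ([odd_power]). If n = 2r + 4,
    there are r + 1 decompositions w =_r c_t h_t c_(t+1)^-1 up to conjugation of
    the factors, where h_t is a letter and c_(t+1) = h_t c_t ([even_split]). The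
    k-th powers of their right-hand sides telescope ([telescope]), so that the
    cost of closing up is shared by r + 1 copies of w^k ([even_power]); the
    resulting excess over (n - 2) / 2 is O(1 / r).

    The sequence defining scl converges to its infimum by subadditivity
    ([fekete]), so that one power of w suffices for an upper bound. *)

(** * Products of commutators *)

Section CommutatorCalculus.
Local Open Scope group_scope.
Variable G : groupType.
Implicit Types (x y z g : G) (r k : nat).

Lemma pcommP r g : prod_of_commutators r g <->
  exists2 s : seq (G * G), size s = r & g = \prod_(p <- s) [~ p.1, p.2].
Proof.
split=> [[s ->]|[s <- ->]]; first by exists s; rewrite ?size_tuple.
by exists (in_tuple s).
Qed.

Lemma pcomm0 : prod_of_commutators 0 (1 : G).
Proof. by apply/pcommP; exists [::]; rewrite ?big_nil. Qed.

Lemma pcomm1 x y : prod_of_commutators 1 [~ x, y].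
Proof. by apply/pcommP; exists [:: (x, y)]; rewrite ?big_seq1. Qed.

Lemma pcommM r r' x y :
  prod_of_commutators r x -> prod_of_commutators r' y ->
  prod_of_commutators (r + r') (x * y).
Proof.
move=> /pcommP[s <- ->] /pcommP[t <- ->]; apply/pcommP.
by exists (s ++ t); rewrite ?size_cat ?big_cat.
Qed.

Lemma pcommJ r x g : prod_of_commutators r x -> prod_of_commutators r (x ^ g).
Proof.
move=> /pcommP[s <- ->]; apply/pcommP.
exists [seq (p.1 ^ g, p.2 ^ g) | p <- s]; rewrite ?size_map // big_map conjg_prod.
by apply: eq_bigr => p _; rewrite conjRg.
Qed.

Lemma pcommV r x : prod_of_commutators r x -> prod_of_commutators r x^-1.
Proof.
move=> /pcommP[s <- ->]; elim: s => [|p s IHs].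
  by rewrite big_nil invg1; exact: pcomm0.
rewrite big_cons invgM /= -addn1; apply: pcommM => //.
by rewrite invgR; exact: pcomm1.
Qed.

Lemma pcommX r g k :
  prod_of_commutators r g -> prod_of_commutators (k * r) (g ^+ k).
Proof.
move=> gr; elim: k => [|k IHk]; first exact: pcomm0.
by rewrite mulSn expgS; exact: pcommM.
Qed.

(** Equality up to r commutators: since conjugates of commutators are
    commutators, the defects r add up under transitivity and under products. *)
Definition eqcomm r x y := prod_of_commutators r (x / y).

Lemma eqcomm_refl x : eqcomm 0 x x.
Proof. by rewrite /eqcomm mulgV; exact: pcomm0. Qed.

Lemma eqcomm_sym r x y : eqcomm r x y -> eqcomm r y x.
Proof. by move/pcommV; rewrite invgF. Qed.

Lemma eqcomm_trans r r' x y z :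
  eqcomm r x y -> eqcomm r' y z -> eqcomm (r + r') x z.
Proof. by move=> xy yz; rewrite /eqcomm -(divgKA y); exact: pcommM. Qed.

Lemma eqcommM r r' x y x' y' :
  eqcomm r x y -> eqcomm r' x' y' -> eqcomm (r + r') (x * x') (y * y').
Proof.
move=> xy /(pcommJ x^-1) xy'; rewrite /eqcomm addnC.
have -> : x * x' / (y * y') = (x' / y') ^ x^-1 * (x / y).
  by rewrite conjgE !gnorm.
exact: pcommM.
Qed.

Lemma eqcommMl r x y z : eqcomm r x y -> eqcomm r (z * x) (z * y).
Proof. exact: (eqcommM (eqcomm_refl z)). Qed.

Lemma eqcommMr r x y z : eqcomm r x y -> eqcomm r (x * z) (y * z).
Proof. by move=> xy; rewrite -[r]addn0; exact: eqcommM (eqcomm_refl z). Qed.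

Lemma eqcommX r x y k : eqcomm r x y -> eqcomm (k * r) (x ^+ k) (y ^+ k).
Proof.
move=> xy; elim: k => [|k IHk]; first exact: eqcomm_refl.
by rewrite !expgS mulSn; exact: eqcommM.
Qed.

(** The basic move: one commutator exchanges two factors, whatever stands
    between them. *)
Lemma eqcomm_swap x q y : eqcomm 1 (x * q * y) (y * q * x).
Proof.
rewrite /eqcomm.
have -> : x * q * y / (y * q * x) = [~ (x * q)^-1, q^-1 * y^-1].
  by rewrite commgEl conjgE !gnorm.
exact: pcomm1.
Qed.

Lemma eqcommC x y : eqcomm 1 (x * y) (y * x).
Proof. by have := eqcomm_swap x 1 y; rewrite !mulg1. Qed.

Lemma eqcommJ x g : eqcomm 1 (x ^ g) x.
Proof. by have := eqcommC g^-1 (x * g); rewrite mulgK. Qed.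

(** Each use of the basic move deals with two more factors x y, so that half
    as many commutators as factors are enough. *)
Lemma eqcommXM x y k : eqcomm k./2 ((x * y) ^+ k) (x ^+ k * y ^+ k).
Proof.
suff [] : eqcomm k./2 ((x * y) ^+ k) (x ^+ k * y ^+ k) /\
  eqcomm (k.+1)./2 ((x * y) ^+ k.+1) (x ^+ k.+1 * y ^+ k.+1) by [].
elim: k => [|k [IHk IHk1]].
  by rewrite !expg0 mulg1 !expg1; split; exact: eqcomm_refl.
split=> //.
(* x^k y^k (x y) x y becomes x^k x (x y) y^k y. *)
have -> : (x * y) ^+ k.+2 = (x * y) ^+ k * (x * y * x * y).
  by rewrite !expgSr !mulgA.
rewrite /= -addn1; apply: eqcomm_trans (eqcommMr _ IHk) _.
have -> : x ^+ k * y ^+ k * (x * y * x * y) = x ^+ k * (y ^+ k * (x * y) * x) * y.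
  by rewrite !mulgA.
have -> : x ^+ k.+2 * y ^+ k.+2 = x ^+ k * (x * (x * y) * y ^+ k) * y.
  have -> : y ^+ k.+2 = y * y ^+ k * y by rewrite expgSr expgS.
  by rewrite !expgSr !mulgA.
apply: eqcommMr; apply: eqcommMl; exact: eqcomm_swap.
Qed.

End CommutatorCalculus.

(** * Upper bounds from splitting alternating words *)

Section AlternatingWords.
Variables (A B : zmodType) (G : groupType) (alpha : A -> G) (beta : B -> G).
Hypothesis alphaD : forall a a', alpha (a + a')%R = (alpha a * alpha a')%g.
Hypothesis betaD : forall b b', beta (b + b')%R = (beta b * beta b')%g.
Local Open Scope group_scope.
Implicit Types (s : seq (A * B)) (a : A) (b : B).

Definition alt_word s : G := \prod_(p <- s) (alpha p.1 * beta p.2).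

Lemma alpha0 : alpha 0%R = 1.
Proof. by apply: (@mulgI _ (alpha 0%R)); rewrite -alphaD addr0 mulg1. Qed.

Lemma beta0 : beta 0%R = 1.
Proof. by apply: (@mulgI _ (beta 0%R)); rewrite -betaD addr0 mulg1. Qed.

Lemma alphaN a : alpha (- a)%R = (alpha a)^-1.
Proof. by apply: (@mulgI _ (alpha a)); rewrite -alphaD subrr alpha0 mulgV. Qed.

Lemma betaN b : beta (- b)%R = (beta b)^-1.
Proof. by apply: (@mulgI _ (beta b)); rewrite -betaD subrr beta0 mulgV. Qed.

Lemma alphaC a a' : alpha a * alpha a' = alpha a' * alpha a.
Proof. by rewrite -!alphaD addrC. Qed.

Lemma betaC b b' : beta b * beta b' = beta b' * beta b.
Proof. by rewrite -!betaD addrC. Qed.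

Lemma alt_word_cons p s : alt_word (p :: s) = alpha p.1 * beta p.2 * alt_word s.
Proof. by rewrite /alt_word big_cons. Qed.

Lemma alt_word_cat s t : alt_word (s ++ t) = alt_word s * alt_word t.
Proof. by rewrite /alt_word big_cat. Qed.

Definition sumA s : A := (\sum_(p <- s) p.1)%R.
Definition sumB s : B := (\sum_(p <- s) p.2)%R.

(** The basic move applied to v_1 (u_2 v_2) u_3 brings the three u's and the
    three v's together. *)
Lemma eqcomm_merge3 a1 b1 a2 b2 a3 b3 :
  eqcomm 1 (alpha a1 * beta b1 * (alpha a2 * beta b2) * (alpha a3 * beta b3))
           (alpha (a1 + a2 + a3)%R * beta (b1 + b2 + b3)%R).
Proof.
have -> : alpha a1 * beta b1 * (alpha a2 * beta b2) * (alpha a3 * beta b3) =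
  alpha a1 * (beta b1 * (alpha a2 * beta b2) * alpha a3) * beta b3.
  by rewrite !mulgA.
have -> : alpha (a1 + a2 + a3)%R * beta (b1 + b2 + b3)%R =
  alpha a1 * (alpha a3 * (alpha a2 * beta b2) * beta b1) * beta b3.
  rewrite addrAC (addrC b1) !alphaD !betaD !mulgA.
  by [].
by apply/eqcommMr/eqcommMl/eqcomm_swap.
Qed.

Lemma eqcomm_merge p s r : size s = r.*2 ->
  eqcomm r (alt_word (p :: s))
           (alpha (p.1 + sumA s)%R * beta (p.2 + sumB s)%R).
Proof.
elim: r p s => [|r IHr] p [|p2 [|p3 s]] //=.
  rewrite /sumA /sumB alt_word_cons /alt_word !big_nil mulg1 !addr0 => _.
  exact: eqcomm_refl.
move=> [sz_s]; rewrite -addn1 addnC.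
have -> : alt_word [:: p, p2, p3 & s] =
  alpha p.1 * beta p.2 * (alpha p2.1 * beta p2.2) * (alpha p3.1 * beta p3.2)
  * alt_word s by rewrite !alt_word_cons !mulgA.
apply: eqcomm_trans (eqcommMr _ (eqcomm_merge3 _ _ _ _ _ _)) _.
have := IHr ((p.1 + p2.1 + p3.1)%R, (p.2 + p2.2 + p3.2)%R) s sz_s.
by rewrite alt_word_cons /= /sumA /sumB !big_cons !addrA.
Qed.

Lemma alt_word_comm s : sumA s = 0%R -> sumB s = 0%R ->
  prod_of_commutators (size s) (alt_word s).
Proof.
move=> sA sB.
suff : eqcomm (size s) (alt_word s) (alpha (sumA s) * beta (sumB s)).
  by rewrite /eqcomm sA sB alpha0 beta0 mulg1 divg1.
elim: s {sA sB} => [|p s IHs].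
  rewrite /alt_word /sumA /sumB !big_nil alpha0 beta0 mulg1.
  exact: eqcomm_refl.
rewrite alt_word_cons /= /sumA /sumB !big_cons -addn1.
apply: eqcomm_trans (eqcommMl _ IHs) _.
rewrite alphaD betaD -!mulgA; apply: eqcommMl; rewrite !mulgA.
by apply: eqcommMr; exact: eqcommC.
Qed.

(** After merging, three pairs remain. Cutting u_1 v_1 u_2 | v_2 u_3 v_3
    yields conjugates of (u_1 + u_2) v_1 and of u_3 (v_2 + v_3), which is the
    inverse of the former as the sums vanish. *)
Lemma odd_split s r : size s = (r.*2 + 3)%N -> sumA s = 0%R -> sumB s = 0%R ->
  exists c g h : G, eqcomm r (alt_word s) (c ^ g * c^-1 ^ h).
Proof.
case: s => [|p1 [|p2 [|p3 s]]]; rewrite ?addn3 //= => -[sz_s].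
rewrite /sumA /sumB !big_cons -/(sumA s) -/(sumB s) => sA sB.
set x := (p1.1 + p2.1)%R; set y := p1.2.
exists (alpha x * beta y), (alpha p2.1), (beta (p2.2 + y)%R)^-1.
rewrite 2!alt_word_cons.
have -> : (alpha x * beta y) ^ alpha p2.1 *
    (alpha x * beta y)^-1 ^ (beta (p2.2 + y)%R)^-1 =
   alpha p1.1 * beta p1.2 * (alpha p2.1 * beta p2.2) *
   (alpha (p3.1 + sumA s)%R * beta (p3.2 + sumB s)%R).
  have -> : (p3.1 + sumA s = - x)%R.
    by apply/eqP; rewrite -addr_eq0 /x addrC -addrA sA.
  have -> : (p3.2 + sumB s = - (p2.2 + y))%R.
    by apply/eqP; rewrite -addr_eq0 /y addrC (addrC p2.2) -addrA sB.
  rewrite alphaN betaN /conjg /x (addrC p1.1) alphaD betaD !invgM !invgK !mulgA.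
  by rewrite mulVg mul1g mulgK.
rewrite [X in eqcomm _ X]mulgA; apply: eqcommMl; exact: eqcomm_merge.
Qed.

(** The sum of every other u, namely of those that [eqcomm_extract] moves to
    the front. *)
Definition skip_sum t s : A := (\sum_(j < t) (nth 0 s j.*2).1)%R.

Lemma skip_sumS t p q s :
  skip_sum t.+1 (p :: q :: s) = (p.1 + skip_sum t s)%R.
Proof. by rewrite /skip_sum big_ord_recl. Qed.

Lemma skip_sum_recr t s : skip_sum t.+1 s = (skip_sum t s + (nth 0 s t.*2).1)%R.
Proof. by rewrite /skip_sum big_ord_recr. Qed.

(** In v u v' u_1 v_1 u_2 v_2 the basic move takes u_1 to the front and merges
    the rest into v u v' again, at the price of one commutator for two pairs,
    which is as efficient as [eqcomm_merge]. *)
Lemma eqcomm_extract t s v x v' : size s = t.*2 ->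
  exists w y w', [/\ (w + w' = v + v' + sumB s)%R,
    (y + skip_sum t s = x + sumA s)%R &
    eqcomm t (beta v * alpha x * beta v' * alt_word s)
             (alpha (skip_sum t s) * (beta w * alpha y * beta w'))].
Proof.
elim: t s v x v' => [|t IHt] [|p [|q s]] v x v' //=.
  move=> _; exists v, x, v'; rewrite /skip_sum /alt_word /sumA /sumB !big_nil.
  rewrite big_ord0 !addr0 alpha0 mulg1 mul1g; split=> //; exact: eqcomm_refl.
move=> [sz_s].
have [w [y [w' [ww' yE wy]]]] := IHt s (v + v' + p.2)%R (x + q.1)%R q.2 sz_s.
exists w, y, w'; rewrite skip_sumS /sumA /sumB !big_cons; split.
- by rewrite ww' !addrA (addrAC _ p.2 q.2).
- by rewrite addrCA yE -/(sumA s) (addrCA x) !addrA.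
rewrite alphaD -[alpha p.1 * _ * _]mulgA -add1n.
apply: eqcomm_trans (eqcommMl _ wy); rewrite !alt_word_cons.
have -> : beta v * alpha x * beta v' *
    (alpha p.1 * beta p.2 * (alpha q.1 * beta q.2 * alt_word s)) =
  beta v * alpha x * beta v' * (alpha p.1 * beta p.2) *
    (alpha q.1 * beta q.2 * alt_word s) by rewrite !mulgA.
have -> : alpha p.1 * (beta (v + v' + p.2)%R * alpha (x + q.1)%R *
    beta q.2 * alt_word s) =
  alpha p.1 * beta p.2 * beta v' * (beta v * alpha x) *
    (alpha q.1 * beta q.2 * alt_word s).
  have -> : (v + v' + p.2 = p.2 + v' + v)%R by rewrite addrC addrA addrAC.
  by rewrite alphaD !betaD !mulgA.
exact/eqcommMr/eqcomm_swap.
Qed.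

(** The first factor collects a, b and the extracted u's around V; the middle
    factor is the next u to be extracted, which is conjugated out of the word
    for free; the last factor contains all remaining letters, so it is inverse
    to the first factor with the middle letter adjoined, that is, to the first
    factor for t + 1. *)
Lemma even_split (a b : A) (V v0 : B) p1 s r t :
  let w := [:: (a, V), (b, v0), p1 & s] in
  let c k := alpha (a + b + skip_sum k s)%R * beta V in
  size w = (r.*2 + 4)%N -> sumA w = 0%R -> sumB w = 0%R -> (t <= r)%N ->
  exists g1 g2 g3 : G, eqcomm r (alt_word w)
     (c t ^ g1 * alpha (nth 0%R s t.*2).1 ^ g2 * (c t.+1)^-1 ^ g3).
Proof.
rewrite /= addn4 /sumA /sumB !big_cons /= => -[sz_s].
rewrite -/(sumA s) -/(sumB s) => sA sB le_tr.
set p := nth 0%R s t.*2; set s1 := take t.*2 s; set s2 := drop t.*2.+1 s.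
have lt_ts : (t.*2 < size s)%N by rewrite sz_s; lia.
have sE : s = s1 ++ p :: s2 by rewrite -drop_nth // cat_take_drop.
have sz1 : size s1 = t.*2 by rewrite size_take lt_ts.
have sz2 : size s2 = (r - t).*2 by rewrite size_drop sz_s; lia.
have skip1 : skip_sum t s1 = skip_sum t s.
  by apply: eq_bigr => j _; rewrite nth_take // ltn_double.
have [w [y [w' [ww' yE wy]]]] := eqcomm_extract v0 p1.1 p1.2 sz1.
have sAE : sumA s = (sumA s1 + (p.1 + sumA s2))%R.
  by rewrite /sumA [in LHS]sE big_cat big_cons.
have sBE : sumB s = (sumB s1 + (p.2 + sumB s2))%R.
  by rewrite /sumB [in LHS]sE big_cat big_cons.
set z := beta w * alpha y * beta w'.
exists (alpha (b + skip_sum t s)%R), z^-1, (beta (w' + p.2 + sumB s2)%R).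
have -> : alt_word [:: (a, V), (b, v0), p1 & s] =
   alpha a * beta V * alpha b * (beta v0 * alpha p1.1 * beta p1.2 * alt_word s1) *
   (alpha p.1 * beta p.2 * alt_word s2).
  by rewrite [in LHS]sE !alt_word_cons alt_word_cat alt_word_cons /= !mulgA.
have -> : (alpha (a + b + skip_sum t s)%R * beta V) ^ alpha (b + skip_sum t s)%R =
   alpha a * beta V * alpha b * alpha (skip_sum t s).
  rewrite /conjg -addrA (addrC a) (alphaD (b + _)%R) !mulgA mulVg mul1g.
  by rewrite alphaD !mulgA.
have -> : (alpha (a + b + skip_sum t.+1 s)%R * beta V)^-1 ^
    beta (w' + p.2 + sumB s2)%R =
    beta w * (alpha (y + sumA s2)%R * beta (w' + p.2 + sumB s2)%R).
  have -> : (y + sumA s2 = - (a + b + skip_sum t.+1 s))%R.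
    apply/eqP; rewrite -addr_eq0 skip_sum_recr -/p -skip1.
    rewrite addrC; move: sA; rewrite sAE.
    have -> : (a + (b + (p1.1 + (sumA s1 + (p.1 + sumA s2)))) =
       a + b + (p1.1 + sumA s1) + p.1 + sumA s2)%R by rewrite !addrA.
    rewrite -yE => <-; apply/eqP; rewrite !addrA.
    by rewrite (addrAC _ p.1 y) (addrAC _ _ y).
  have -> : (w = - V - (w' + p.2 + sumB s2))%R.
    apply/eqP; rewrite -subr_eq0 opprB opprK !addrA ww'.
    by move: sB; rewrite sBE addrC !addrA => ->.
  by rewrite alphaN (betaD (- V)) betaC !betaN /conjg invgM !mulgA.
rewrite -(subnKC le_tr); apply: eqcomm_trans.
  by apply: eqcommMr; apply: eqcommMl; exact: wy.
rewrite skip1 -/z.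
have -> : alpha a * beta V * alpha b * (alpha (skip_sum t s) * z) *
    (alpha p.1 * beta p.2 * alt_word s2) =
  alpha a * beta V * alpha b * alpha (skip_sum t s) * alpha p.1 ^ z^-1 *
    beta w * alt_word ((y, w' + p.2)%R :: s2).
  rewrite alt_word_cons /= betaD /conjg invgK !mulgA; do 2?congr (_ * _).
  by rewrite /z !invgM !mulgA !mulgVK.
rewrite !mulgA -!(mulgA _ (alpha (y + _)%R)); apply: eqcommMl.
exact: (eqcomm_merge (y, w' + p.2)%R).
Qed.


(** The powers of the two mutually inverse pieces cancel up to two
    conjugations. *)
Lemma odd_power s r k : size s = (r.*2 + 3)%N -> sumA s = 0%R -> sumB s = 0%R ->
  prod_of_commutators (k * r + k./2 + 2) (alt_word s ^+ k).
Proof.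
move=> sz sA sB; have [c [g [h sE]]] := odd_split sz sA sB.
suff : eqcomm (k * r + k./2 + 2) (alt_word s ^+ k) (c ^+ k / c ^+ k).
  by rewrite /eqcomm mulgV divg1.
apply: eqcomm_trans (eqcomm_trans (eqcommX k sE) (eqcommXM _ _ _)) _.
rewrite -!conjXg expVgn; apply: (@eqcommM _ 1 1); exact: eqcommJ.
Qed.

(** Multiplying the k-th powers of the decompositions for t = 0, ..., d - 1,
    the inverse of c_(t+1)^k ending one of them cancels the start of the next.
    The number 3 counts the conjugations to be undone in each. *)
Lemma telescope (c : nat -> G) (h : nat -> A) (w : G) q r d k :
  (forall t, (t < d)%N -> exists g1 g2 g3 : G,
     eqcomm r w (c t ^ g1 * alpha (h t) ^ g2 * (c t.+1)^-1 ^ g3)) ->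
  q = (k * r + k./2 + k./2 + 3)%N ->
  eqcomm (d * q) (w ^+ (k * d))
    (c 0 ^+ k * alpha (\sum_(j < d) h j)%R ^+ k * c d ^- k).
Proof.
move=> wE qE; elim: d wE => [|d IHd] wE.
  by rewrite muln0 big_ord0 alpha0 expg1n mulg1 mulgV; exact: eqcomm_refl.
have [g1 [g2 [g3 wd]]] := wE d (ltnSn d).
rewrite mulnSr expgnDr mulSn addnC big_ord_recr /= alphaD.
have -> : c 0 ^+ k * (alpha (\sum_(i < d) h i)%R * alpha (h d)) ^+ k * c d.+1 ^- k =
  c 0 ^+ k * alpha (\sum_(i < d) h i)%R ^+ k * c d ^- k *
    (c d ^+ k * alpha (h d) ^+ k * (c d.+1)^-1 ^+ k).
  rewrite expgMn; last exact: alphaC.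
  by rewrite expVgn !mulgA mulgVK.
apply: eqcommM; first by apply: IHd => t lt_td; apply: wE; exact: ltnW.
rewrite qE; apply: (@eqcomm_trans _ _ 3).
  apply: eqcomm_trans (eqcomm_trans (eqcommX k wd) (eqcommXM _ _ _)) _.
  exact/eqcommMr/eqcommXM.
rewrite -!conjXg.
apply: (@eqcommM _ 2 1); last exact: eqcommJ.
by apply: (@eqcommM _ 1 1); exact: eqcommJ.
Qed.

(** After telescoping, c_0^k h^k c_d^-k remains with c_d = h c_0, where h is
    the product of all middle letters; k/2 + 1 commutators dispose of it. *)
Lemma even_power s r k : size s = (r.*2 + 4)%N -> sumA s = 0%R -> sumB s = 0%R ->
  prod_of_commutators (r.+1 * (k * r + k./2 + k./2 + 3) + k./2 + 1)
    (alt_word s ^+ (k * r.+1)).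
Proof.
case: s => [|[a V] [|[b v0] [|p1 s]]] sz sA sB; rewrite ?addn4 // in sz.
pose c t := alpha (a + b + skip_sum t s)%R * beta V.
pose h t := (nth 0%R s t.*2).1.
have tele := @telescope c h (alt_word [:: (a, V), (b, v0), p1 & s]) _ r r.+1 k
   _ erefl.
rewrite -addnA -[_ ^+ (k * r.+1)]divg1.
apply: eqcomm_trans.
  by apply: tele => t lt_tr; apply: even_split; rewrite ?addn4.
have -> : c r.+1 = alpha (\sum_(j < r.+1) h j)%R * c 0.
  rewrite /c /skip_sum big_ord0 addr0 mulgA -alphaD addrC.
  by [].
have {}tele : eqcomm k./2 ((alpha (\sum_(j < r.+1) h j)%R * c 0) ^+ k)
   (alpha (\sum_(j < r.+1) h j)%R ^+ k * c 0 ^+ k) by exact: eqcommXM.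
rewrite -(mulgV ((alpha (\sum_(j < r.+1) h j)%R * c 0) ^+ k)).
apply: eqcommMr; rewrite addnC; apply: eqcomm_trans (eqcommC _ _) _.
exact: eqcomm_sym.
Qed.

End AlternatingWords.

(** * Normal forms and quasimorphisms on a free product *)

Section NormalForm.
Variables A B : zmodType.
Local Open Scope ring_scope.
Local Notation letter := (A + B)%type.
Local Notation word := (seq letter).
Implicit Types (c d : letter) (s t r : word).

Definition nonzero c : bool :=
  match c with inl a => a != 0 | inr b => b != 0 end.

Definition opposite c d : bool :=
  match c, d with inl _, inr _ | inr _, inl _ => true | _, _ => false end.

Definition reduced r : bool := all nonzero r && sorted opposite r.

(** Multiplication of a reduced word by a letter on the left. The free product
    acts on reduced words through [push] ([fprod_eq_push]), which makes
    reduced representatives unique. *)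
Definition push c r : word :=
  match c, r with
  | inl a, inl a' :: r' => if a + a' == 0 then r' else inl (a + a') :: r'
  | inr b, inr b' :: r' => if b + b' == 0 then r' else inr (b + b') :: r'
  | _, _ => if nonzero c then c :: r else r
  end.

Definition normal_form s : word := foldr push [::] s.

Lemma opposite_sym : symmetric opposite.
Proof. by case=> [?|?] [?|?]. Qed.

Lemma reduced_cons c r : reduced (c :: r) -> reduced r.
Proof. by rewrite /reduced /= => /andP[/andP[_ ->] /path_sorted ->]. Qed.

Lemma push_reduced c r : reduced r -> reduced (push c r).
Proof.
case: c r => [a|b] [|[c|c] r] /= red.
- by case: (eqVneq a 0) => //; rewrite /reduced /= => ->.
- case: (eqVneq (a + c) 0) => [_|ac]; first exact: reduced_cons red.
  by move: red; rewrite /reduced /= ac => /andP[/andP[_ ->]]; case: r => [|[]].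
- by case: (eqVneq a 0) => // a_nz; move: red; rewrite /reduced /= a_nz.
- by case: (eqVneq b 0) => //; rewrite /reduced /= => ->.
- by case: (eqVneq b 0) => // b_nz; move: red; rewrite /reduced /= b_nz.
- case: (eqVneq (b + c) 0) => [_|bc]; first exact: reduced_cons red.
  by move: red; rewrite /reduced /= bc => /andP[/andP[_ ->]]; case: r => [|[]].
Qed.

Lemma foldr_push_reduced s r : reduced r -> reduced (foldr push r s).
Proof. by move=> r_red; elim: s => //= c s; exact: push_reduced. Qed.

Lemma foldr_push_cat s r : reduced (s ++ r) -> foldr push r s = s ++ r.
Proof.
elim: s => //= c s IHs red; rewrite IHs ?(reduced_cons red) //.
move: red; rewrite /reduced /=; move: (s ++ r) => u.
by case: c u => [a|b] [|[?|?] u] /= /andP[/andP[nz _] alt]; rewrite ?nz.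
Qed.

Lemma push_l0 r : reduced r -> push (inl 0) r = r.
Proof.
by case: r => [|[a|b] r] /=; rewrite ?eqxx // add0r /reduced /=; case: eqP.
Qed.

Lemma push_r0 r : reduced r -> push (inr 0) r = r.
Proof.
by case: r => [|[a|b] r] /=; rewrite ?eqxx // add0r /reduced /=; case: eqP.
Qed.

Lemma push_lD a a' r : reduced r ->
  push (inl a) (push (inl a') r) = push (inl (a + a')) r.
Proof.
case: r => [|[c|c] r] /=.
- by case: (eqVneq a' 0) => [->|_ _]; rewrite ?addr0 //=; case: eqP.
- case: (eqVneq (a' + c) 0) => [a'c|_ _]; last by rewrite /= addrA.
  rewrite -addrA a'c addr0; case: r => [|[c'|c'] r] /=; rewrite /reduced /=;
    by rewrite ?andbF //; case: (eqVneq a 0).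
- by case: (eqVneq a' 0) => [->|_ _]; rewrite ?addr0 //=; case: eqP.
Qed.

Lemma push_rD b b' r : reduced r ->
  push (inr b) (push (inr b') r) = push (inr (b + b')) r.
Proof.
case: r => [|[c|c] r] /=.
- by case: (eqVneq b' 0) => [->|_ _]; rewrite ?addr0 //=; case: eqP.
- by case: (eqVneq b' 0) => [->|_ _]; rewrite ?addr0 //=; case: eqP.
- case: (eqVneq (b' + c) 0) => [b'c|_ _]; last by rewrite /= addrA.
  rewrite -addrA b'c addr0; case: r => [|[c'|c'] r] /=; rewrite /reduced /=;
    by rewrite ?andbF //; case: (eqVneq b 0).
Qed.

Lemma fprod_eq_push s t r : fprod_eq s t -> reduced r ->
  foldr push r s = foldr push r t.
Proof.
move=> st; elim: st r => {s t}.
- by [].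
- by move=> s t _ IH r r_red; rewrite IH.
- by move=> s t u _ IH1 _ IH2 r r_red; rewrite IH1 // IH2.
- move=> s s' t t' _ IHs _ IHt r r_red; rewrite !foldr_cat IHt // IHs //.
  exact: foldr_push_reduced.
- by move=> r; exact: push_l0.
- by move=> r; exact: push_r0.
- by move=> a a' r; exact: push_lD.
- by move=> b b' r; exact: push_rD.
Qed.

Lemma fprod_eq_normal_form s : fprod_eq s (normal_form s).
Proof.
elim: s => [|c s IHs]; first exact: fprod_eq_refl.
rewrite -cat1s; apply: fprod_eq_trans (fprod_eq_cat (fprod_eq_refl _) IHs) _.
rewrite /normal_form /=; move: (foldr _ _ _) => r.
have tail u v : fprod_eq u v -> fprod_eq (u ++ r) (v ++ r).
  by move/fprod_eq_cat; apply; exact: fprod_eq_refl.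
have new : fprod_eq ([:: c] ++ r) (if nonzero c then c :: r else r).
  case: c => [a|b] /=; case: eqVneq => [->|_]; try exact: fprod_eq_refl.
  - exact: tail (fprod_eq_l0 _ _).
  - exact: tail (fprod_eq_r0 _ _).
case: c r tail new => [a|b] [|[c|c] r] tail new //=.
- case: eqVneq => [ac|_].
  + apply: (@fprod_eq_cat _ _ [:: inl a; inl c] [::]); last exact: fprod_eq_refl.
    by apply: fprod_eq_trans (fprod_eq_lD _ _ _) _; rewrite ac; exact: fprod_eq_l0.
  + apply: (@fprod_eq_cat _ _ [:: inl a; inl c] [:: inl (a + c)]).
      exact: fprod_eq_lD.
    exact: fprod_eq_refl.
- case: eqVneq => [bc|_].
  + apply: (@fprod_eq_cat _ _ [:: inr b; inr c] [::]); last exact: fprod_eq_refl.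
    by apply: fprod_eq_trans (fprod_eq_rD _ _ _) _; rewrite bc; exact: fprod_eq_r0.
  + apply: (@fprod_eq_cat _ _ [:: inr b; inr c] [:: inr (b + c)]).
      exact: fprod_eq_rD.
    exact: fprod_eq_refl.
Qed.

Lemma normal_form_reduced s : reduced (normal_form s).
Proof. exact: foldr_push_reduced. Qed.

Lemma reduced_normal_form s : reduced s -> normal_form s = s.
Proof. by move=> s_red; rewrite /normal_form foldr_push_cat cats0. Qed.

Lemma fprod_eq_nf s t : fprod_eq s t -> normal_form s = normal_form t.
Proof. by move=> st; exact: fprod_eq_push. Qed.

Lemma reduced_word_inv s : reduced s -> reduced (word_inv s).
Proof.
rewrite /reduced /word_inv all_rev rev_sorted all_map sorted_map.
move=> /andP[s_nz s_alt]; apply/andP; split.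
  by apply: sub_all s_nz => -[a|b] /=; rewrite oppr_eq0.
by apply: sub_sorted s_alt => -[a|b] [a'|b'].
Qed.

Lemma normal_form_inv s : normal_form (word_inv s) = word_inv (normal_form s).
Proof.
rewrite -[RHS]reduced_normal_form; last exact/reduced_word_inv/normal_form_reduced.
exact/fprod_eq_nf/fprod_eq_inv/fprod_eq_normal_form.
Qed.

Section Quasimorphism.
Variables (R : realFieldType) (wt : letter -> R).

Hypothesis wtN : forall c, wt (letter_inv c) = - wt c.
Hypothesis wt_l : forall a a',
  `|wt (inl (a + a')) - wt (inl a) - wt (inl a')| <= 2^-1.
Hypothesis wt_r : forall b b',
  `|wt (inr (b + b')) - wt (inr b) - wt (inr b')| <= 2^-1.

Definition weight s : R := \sum_(c <- s) wt c.

Lemma weight_cat s t : weight (s ++ t) = weight s + weight t.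
Proof. by rewrite /weight big_cat. Qed.

Lemma weight_cons c s : weight (c :: s) = wt c + weight s.
Proof. by rewrite /weight big_cons. Qed.

Lemma weight_nil : weight [::] = 0.
Proof. by rewrite /weight big_nil. Qed.

Lemma weight_inv s : weight (word_inv s) = - weight s.
Proof.
elim: s => [|c s IHs]; first by rewrite /weight !big_nil oppr0.
rewrite -cat1s word_inv_cat weight_cat IHs /= weight_cons opprD addrC.
by rewrite /word_inv /= weight_cons /weight big_nil addr0 wtN.
Qed.

(** Cancelling pairs of letters have opposite weights, so they contribute
    nothing; the process ends when the junction is reduced, or when two letters
    of one factor merge into a nonzero letter, and only the latter has a
    defect. *)
Lemma weight_push s t : reduced s -> reduced t ->
  `|weight (foldr push t s) - weight s - weight t| <= 2^-1.
Proof.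
have small s' u : reduced (s' ++ u) ->
    weight (foldr push u s') - weight s' = weight u.
  by move=> /foldr_push_cat ->; rewrite weight_cat addrAC subrr add0r.
have half : (0 : R) <= 2^-1 by rewrite invr_ge0.
elim/last_ind: s t => [|s c IHs] t s_red t_red.
  by rewrite /weight big_nil /= subr0 subrr normr0.
case: (boolP (reduced (rcons s c ++ t))) => [/small -> | ].
  by rewrite subrr normr0.
have s_red' : reduced s.
  move: s_red; rewrite -cats1 /reduced all_cat => /andP[/andP[-> _]].
  by case: (s) => //= x s1; rewrite cat_path => /andP[].
case: t t_red => [|d t] t_red; first by rewrite cats0 s_red.
have t_red' := reduced_cons t_red.
have join e : reduced (rcons s c) -> nonzero e -> opposite c =1 opposite e ->
    opposite d =1 opposite e -> reduced (s ++ e :: t).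
  move=> sc e_nz ce de; move: sc t_red; rewrite /reduced.
  rewrite -cats1 !all_cat /= e_nz.
  move=> /andP[/and3P[-> _ _] sc] /andP[/andP[_ ->] dt] /=.
  have et : path opposite e t by case: (t) dt => //= x t1; rewrite de.
  case: (s) sc => //= x s1; rewrite !cat_path /= andbT et andbT => /andP[-> /=].
  by rewrite -!(opposite_sym _ (last x s1)) ce.
rewrite -cats1 foldr_cat weight_cat !weight_cons /= => not_red.
have {not_red} : ~~ opposite c d.
  apply: contra not_red => cd; move: s_red t_red; rewrite /reduced -catA all_cat /=.
  rewrite -cats1 all_cat /= => /andP[/and3P[-> -> _] sc] /andP[/andP[-> ->] dt] /=.
  by case: (s) sc => [|x s1] /=;
    rewrite ?cat_path /= cd dt ?andbT // => /andP[-> ->].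
have nz_d : nonzero d by move: t_red => /andP[/andP[]].
rewrite weight_nil addr0.
case: c d s_red t_red join nz_d => [a|b] [a'|b'] s_red t_red join nz_d //= _.
- case: eqVneq => [aa'|aa'].
    have -> : wt (inl a') = - wt (inl a).
      by rewrite -wtN /=; congr (wt (inl _)); apply/eqP; rewrite -addr_eq0 addrC aa'.
    set u := weight _; have -> : u - (weight s + wt (inl a)) -
        (- wt (inl a) + weight t) = u - weight s - weight t by lra.
    exact: IHs.
  have sred : reduced (s ++ inl (a + a') :: t) by apply: join.
  rewrite opprD addrA (small _ _ sred) weight_cons.
  have -> : wt (inl (a + a')) + weight t - wt (inl a) - (wt (inl a') + weight t) =
    wt (inl (a + a')) - wt (inl a) - wt (inl a') by rewrite opprD !addrA; lra.
  exact: wt_l.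
- case: eqVneq => [aa'|aa'].
    have -> : wt (inr b') = - wt (inr b).
      by rewrite -wtN /=; congr (wt (inr _)); apply/eqP; rewrite -addr_eq0 addrC aa'.
    set u := weight _; have -> : u - (weight s + wt (inr b)) -
        (- wt (inr b) + weight t) = u - weight s - weight t by lra.
    exact: IHs.
  have sred : reduced (s ++ inr (b + b') :: t) by apply: join.
  rewrite opprD addrA (small _ _ sred) weight_cons.
  have -> : wt (inr (b + b')) + weight t - wt (inr b) - (wt (inr b') + weight t) =
    wt (inr (b + b')) - wt (inr b) - wt (inr b') by rewrite opprD !addrA; lra.
  exact: wt_r.
Qed.

Definition qmorph (g : free_product A B) : R := weight (normal_form (repr g)).

Lemma qmorphE s : qmorph (fprod_pi s) = weight (normal_form s).
Proof. by congr weight; apply/fprod_eq_nf/fprod_eq_repr. Qed.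

Lemma qmorph_defect g h : `|qmorph (g * h)%g - qmorph g - qmorph h| <= 2^-1.
Proof.
rewrite -[g]fprod_pi_repr -[h]fprod_pi_repr -[(_ * _)%g]/(fprod_mul _ _) fprod_mulE.
rewrite !qmorphE; move: (repr g) (repr h) => s t.
have -> : normal_form (s ++ t) = foldr push (normal_form t) (normal_form s).
  rewrite /normal_form foldr_cat -!/(normal_form _).
  exact: fprod_eq_push (fprod_eq_normal_form s) (normal_form_reduced t).
by apply: weight_push; exact: normal_form_reduced.
Qed.

Lemma qmorphV g : qmorph g^-1%g = - qmorph g.
Proof.
rewrite -[g]fprod_pi_repr -[_^-1%g]/(fprod_inv _) fprod_invE !qmorphE.
by rewrite normal_form_inv weight_inv.
Qed.

Lemma qmorph_commutator g h : `|qmorph [~ g, h]%g| <= 3 / 2.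
Proof.
rewrite /commg /conjg.
have := qmorph_defect g^-1%g (h^-1 * (g * h))%g.
have := qmorph_defect h^-1%g (g * h)%g.
have := qmorph_defect g h.
rewrite !qmorphV !ler_norml => /andP[? ?] /andP[? ?] /andP[? ?].
by apply/andP; split; lra.
Qed.

(** A commutator is at most 3/2 by oddness and three defects, and each
    multiplication adds 1/2. *)
Lemma qmorph_pcomm k g : prod_of_commutators k g -> qmorph g <= 2 * k%:R.
Proof.
case=> s ->; rewrite -{2}(size_tuple s); elim: (val s) => [|p t IHt] /=.
  rewrite big_nil -[1%g]/(fprod_pi [::]) qmorphE /weight /normal_form /= big_nil.
  by rewrite mulr0.
rewrite big_cons -[in leRHS]natr1.
set y := bigop _ _ _ in IHt *; have := qmorph_defect [~ p.1, p.2]%g y.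
have := qmorph_commutator p.1 p.2; move: IHt.
rewrite !ler_norml => ? /andP[? ?] /andP[? ?]; lra.
Qed.

End Quasimorphism.
End NormalForm.

(** * A sawtooth function adapted to given elements *)

Section SawtoothWeight.
Variables (R : realFieldType) (A : zmodType) (n : nat) (u : 'I_n -> A).
Hypothesis no_short_zero : forall s : seq 'I_n,
  (0 < size s < n)%N -> (\sum_(j <- s) u j != 0)%R.
Implicit Types (a b c : A) (s : seq 'I_n).
Local Open Scope ring_scope.

(** Twice the length of a with respect to the semigroup generated by the u_j,
    cut off at n. The empty sum is not counted, so that 0 has the value n when
    no short sum vanishes. *)
Definition trunc_len a : nat :=
  \big[Order.min/n]_(p < n | (0 < p)%N && [exists s : p.-tuple 'I_n,
                                        \sum_(j <- s) u j == a]) p.*2.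

Lemma trunc_len_le a : (trunc_len a <= n)%N.
Proof.
by rewrite -leEnat; exact: bigmin_le_id.
Qed.

Lemma trunc_len_sum s :
  (0 < size s)%N -> (trunc_len (\sum_(j <- s) u j) <= (size s).*2)%N.
Proof.
move=> s_gt0; have [lt_sn|le_ns] := ltnP (size s) n; last first.
  by apply: leq_trans (trunc_len_le _) _; lia.
rewrite -leEnat; apply: (@bigmin_le_cond _ nat _ n (Ordinal lt_sn) _
  (fun p : 'I_n => (p : nat).*2)).
by rewrite s_gt0; apply/existsP; exists (in_tuple s).
Qed.

Lemma trunc_lenP a : (trunc_len a < n)%N ->
  exists s, [/\ (0 < size s)%N, \sum_(j <- s) u j = a & trunc_len a = (size s).*2].
Proof.
rewrite /trunc_len; elim/big_rec: _ => [|p m /andP[p_gt0 /existsP[s /eqP sE]] IHm].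
  by rewrite ltnn.
rewrite minEnat /minn; case: ifP => // _ _.
by exists s; rewrite size_tuple.
Qed.

Lemma trunc_lenD a b : (trunc_len (a + b) <= trunc_len a + trunc_len b)%N.
Proof.
have [/trunc_lenP[s [s_gt0 <- ->]]|?] := ltnP (trunc_len a) n; last first.
  by apply: leq_trans (trunc_len_le _) _; lia.
have [/trunc_lenP[t [t_gt0 <- ->]]|?] := ltnP (trunc_len b) n; last first.
  by apply: leq_trans (trunc_len_le _) _; lia.
rewrite -big_cat -doubleD -size_cat; apply: trunc_len_sum.
by rewrite size_cat ltn_addr.
Qed.

(** If the three values on the right are all below n, then concatenating the
    three representations yields a vanishing sum, which has length at least n.
    If only one reaches n, say the one of c, then the value of -c = a + b is
    bounded by subadditivity. In the remaining cases the cut-off suffices. *)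
Lemma trunc_len_triangle a b c : a + b + c = 0 ->
  (trunc_len (- a) + trunc_len (- b) + trunc_len (- c)
     <= n + (trunc_len a + trunc_len b + trunc_len c))%N.
Proof.
move=> abc.
have opp x y z : x + y + z = 0 -> (trunc_len (- z) <= trunc_len x + trunc_len y)%N.
  by move/eqP; rewrite addr_eq0 => /eqP <-; exact: trunc_lenD.
have lc := opp a b c abc.
have lb : (trunc_len (- b) <= trunc_len c + trunc_len a)%N.
  by apply: opp; rewrite -addrA addrC.
have la : (trunc_len (- a) <= trunc_len b + trunc_len c)%N.
  by apply: opp; rewrite addrC addrA.
have big : (trunc_len a < n -> trunc_len b < n -> trunc_len c < n ->
   n.*2 <= trunc_len a + trunc_len b + trunc_len c)%N.
  move=> /trunc_lenP[s [s_gt0 sE ->]] /trunc_lenP[t [t_gt0 tE ->]].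
  move=> /trunc_lenP[r [r_gt0 rE ->]].
  rewrite -!doubleD leq_double leqNgt; apply/negP => small.
  suff /no_short_zero/eqP : (0 < size (s ++ t ++ r) < n)%N.
    by apply; rewrite !big_cat /= addrA sE tE rE.
  by rewrite !size_cat; lia.
have := trunc_len_le (- a); have := trunc_len_le (- b); have := trunc_len_le (- c).
have := trunc_len_le a; have := trunc_len_le b; have := trunc_len_le c.
lia.
Qed.

(** On Z/n, with all u_j equal to 1, this is the function 1/2 - {a/n} off 0. *)
Definition sawtooth a : R := ((trunc_len (- a))%:R - (trunc_len a)%:R) / (2 * n%:R).

Lemma sawtoothN a : sawtooth (- a) = - sawtooth a.
Proof. by rewrite /sawtooth opprK -mulNr opprB. Qed.

Lemma sawtooth_triangle a b : (0 < n)%N ->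
  `|sawtooth (a + b) - sawtooth a - sawtooth b| <= 2^-1.
Proof.
move=> n_gt0; have n_gt0' : (0 : R) < n%:R by rewrite ltr0n.
have [t1 t2] : 
   (trunc_len (- a) + trunc_len (- b) + trunc_len (a + b)
     <= n + (trunc_len a + trunc_len b + trunc_len (- (a + b))))%N /\
   (trunc_len a + trunc_len b + trunc_len (- (a + b)) <= n + 
     (trunc_len (- a) + trunc_len (- b) + trunc_len (a + b)))%N.
  split.
    by rewrite -{1}[a + b]opprK; apply: trunc_len_triangle; rewrite subrr.
  rewrite -{1}[a]opprK -{1}[b]opprK; apply: trunc_len_triangle.
  by rewrite -opprD addNr.
move: t1 t2; rewrite -!(ler_nat R) !natrD /sawtooth => t1 t2.
rewrite -!mulrBl normrM (@ger0_norm _ (_^-1)) ?invr_ge0 ?mulr_ge0 ?ler0n //.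
rewrite ler_pdivrMr ?mulr_gt0 // mulKf ?pnatr_eq0 //.
rewrite ler_norml; apply/andP; split; lra.
Qed.

Lemma sawtooth_gen j : (1 < n)%N -> 2^-1 - n%:R^-1 <= sawtooth (u j).
Proof.
move=> n_gt1; have n_gt0 : (0 : R) < n%:R by rewrite ltr0n ltnW.
have lenN : trunc_len (- u j) = n.
  apply/eqP; rewrite eqn_leq trunc_len_le leqNgt; apply/negP => lt_n.
  have [s [s_gt0 sE lenE]] := trunc_lenP lt_n.
  have /no_short_zero/eqP : (0 < size (j :: s) < n)%N by rewrite /=; lia.
  by apply; rewrite big_cons sE subrr.
have : (trunc_len (u j) <= 2)%N.
  by have := @trunc_len_sum [:: j] isT; rewrite big_seq1.
rewrite -(ler_nat R) => len2.
rewrite /sawtooth lenN ler_pdivlMr ?mulr_gt0 // mulrBl mulKf ?pnatr_eq0 //.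
by rewrite mulrCA mulVf ?gt_eqF // mulr1; lra.
Qed.
End SawtoothWeight.

(** * Stable commutator length as an infimum *)

Section StableLength.
Local Open Scope classical_set_scope.
Local Open Scope ring_scope.
Import numFieldNormedType.Exports.

Section Fekete.
Variables (R : realType) (u : nat -> nat).
Hypothesis u0 : u 0 = 0%N.
Hypothesis uD : forall m k, (u (m + k) <= u m + u k)%N.

Let ratios : set R := [set x | exists2 k, (0 < k)%N & x = (u k)%:R / k%:R].

Lemma subadditive_mul q m r : (u (q * m + r) <= q * u m + r * u 1)%N.
Proof.
elim: q => [|q IHq].
  rewrite !add0n; elim: r => [|r IHr]; first by rewrite u0.
  by rewrite -addn1 mulnDl mul1n; apply: leq_trans (uD _ _) _; rewrite leq_add2r.
rewrite !mulSn -!addnA; apply: leq_trans (uD _ _) _.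
by rewrite leq_add2l.
Qed.

(** Fekete's lemma: with k = q m + r and r < m, subadditivity gives
    u_k / k <= u_m / m + m u_1 / k, for any m. *)
Lemma fekete : (fun k => (u k)%:R / k%:R : R) @ \oo --> inf ratios.
Proof.
have lb0 : lbound ratios 0 by move=> _ [k _ ->]; rewrite divr_ge0.
have ratios_inf : has_inf ratios.
  by split; [exists ((u 1)%:R / 1%:R), 1%N | exists 0].
apply/cvgrPdist_lt => e e_gt0.
have [_ [m m_gt0 ->] m_lt] := inf_adherent (divr_gt0 e_gt0 (ltr0n _ 2)) ratios_inf.
pose N := (Num.truncn (2 * (m%:R * (u 1)%:R) / e)).+1.
exists N.+1 => // k /= lt_Nk.
have k_gt0 : (0 < k)%N by exact: leq_trans lt_Nk.
have k_gt0R : (0 : R) < k%:R by rewrite ltr0n.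
have m_gt0R : (0 : R) < m%:R by rewrite ltr0n.
have inf_le : inf ratios <= (u k)%:R / k%:R.
  by apply: ge_inf; [exists 0 | exists k].
rewrite ler0_norm ?subr_le0 // opprB ltrBlDr.
suff : (u k)%:R / k%:R <= (u m)%:R / m%:R + m%:R * (u 1)%:R / k%:R :> R.
  move=> /le_lt_trans; apply.
  suff : m%:R * (u 1)%:R / k%:R < e / 2 by move: m_lt; lra.
  rewrite ltr_pdivrMr // -ltr_pdivrMl ?divr_gt0 //.
  rewrite invf_div mulrAC.
  apply: lt_le_trans (truncnS_gt _) _.
  by rewrite ler_nat -/N ltnW.
rewrite ler_pdivrMr // mulrDl divfK ?gt_eqF //.
rewrite {1}(divn_eq k m).
apply: (@le_trans _ _ ((k %/ m * u m + k %% m * u 1)%N%:R)).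
  by rewrite ler_nat subadditive_mul.
rewrite natrD lerD // ?natrM.
  rewrite mulrC -mulrA ler_wpM2l // mulrC ler_pdivlMr // -natrM ler_nat.
  exact: leq_trunc_div.
by rewrite ler_wpM2r // ler_nat ltnW // ltn_mod.
Qed.

End Fekete.

Section Scl.
Local Open Scope group_scope.
Variables (R : realType) (G : groupType).
Implicit Types g : G.

Lemma cl_le r g : prod_of_commutators r g -> (cl g <= r)%N.
Proof.
move=> gr; rewrite /cl; case: pselect => // ex_k.
by case: ex_minnP => m _ /(_ r); apply; exact/asboolP.
Qed.

Lemma cl_prod r g : prod_of_commutators r g -> prod_of_commutators (cl g) g.
Proof.
move=> gr; rewrite /cl; case: pselect => [ex_k|[]]; last by exists r; exact/asboolP.
by case: ex_minnP => m /asboolP.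
Qed.

Lemma scl_inf r g : prod_of_commutators r g ->
  scl R g = inf [set x | exists2 k, (0 < k)%N & x = ((cl (g ^+ k))%:R / k%:R)%R].
Proof.
move=> gr; apply: cvg_lim => //; apply: (@fekete R (fun k => cl (g ^+ k))).
  by apply/eqP; rewrite -leqn0; apply: cl_le; exact: pcomm0.
move=> m k; apply: cl_le; rewrite expgnDr.
by apply: pcommM; apply: cl_prod; exact: pcommX gr.
Qed.

Lemma scl_ge r g (c : R) : prod_of_commutators r g ->
  (forall k m, prod_of_commutators m (g ^+ k) -> c * k%:R <= m%:R)%R ->
  (c <= scl R g)%R.
Proof.
move=> gr c_le; rewrite (scl_inf gr).
apply: lb_le_inf; first by exists ((cl (g ^+ 1))%:R / 1%:R)%R, 1%N.
move=> _ [k k_gt0 ->]; rewrite ler_pdivlMr ?ltr0n //; apply: c_le.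
exact/cl_prod/(pcommX _ gr).
Qed.

Lemma scl_le r g k m : prod_of_commutators r g -> (0 < k)%N ->
  prod_of_commutators m (g ^+ k) -> (scl R g <= m%:R / k%:R)%R.
Proof.
move=> gr k_gt0 gm; rewrite (scl_inf gr).
apply: (@le_trans _ _ ((cl (g ^+ k))%:R / k%:R)%R).
  apply: ge_inf; last by exists k.
  by exists 0%R => _ [j _ ->]; rewrite divr_ge0.
by rewrite ler_wpM2r ?invr_ge0 // ler_nat; exact: cl_le.
Qed.

End Scl.
End StableLength.

(** * Hyperplanes of vanishing sums *)

Section Hyperplanes.
Local Open Scope ring_scope.
Variable n : nat.

Definition hyperplane (c : 'I_n -> nat) : {pred 'rV[int]_n} :=
  [pred z : 'rV[int]_n | (z \in V n) && (\sum_j z 0 j *+ c j == 0)].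

Lemma hyperplane_submodule c : submodule (hyperplane c).
Proof.
split; last by move=> z /andP[].
split; first by rewrite !inE !big1 ?eqxx // => j _; rewrite mxE ?mul0rn.
move=> y z; rewrite !inE => /andP[/eqP y0 /eqP yc] /andP[/eqP z0 /eqP zc].
have -> : \sum_j (y - z) 0 j = \sum_j y 0 j - \sum_j z 0 j.
  by rewrite -sumrB; apply: eq_bigr => j _; rewrite !mxE.
have -> : \sum_j (y - z) 0 j *+ c j = \sum_j y 0 j *+ c j - \sum_j z 0 j *+ c j.
  by rewrite -sumrB; apply: eq_bigr => j _; rewrite !mxE mulrnBl.
by rewrite y0 yc z0 zc subrr eqxx.
Qed.

(** Clear denominators. *)
Lemma int_free_rat k (A : 'M[int]_(k, n)) :
  (forall c : 'rV[int]_k, c *m A = 0 -> c = 0) ->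
  row_free (map_mx intr A : 'M[rat]_(k, n)).
Proof.
move=> A_free; rewrite -kermx_eq0; apply/eqP/row_matrixP => i; rewrite row0.
have : row i (kermx (map_mx intr A)) *m map_mx intr A = 0 :> 'rV[rat]_n.
  by rewrite -row_mul mulmx_ker row0.
move: (row i _) => v vA.
pose d := \prod_j denq (v 0 j).
have d_nz : d%:~R != 0 :> rat.
  by rewrite intr_eq0; apply/prodf_neq0 => j _; exact: denq_neq0.
pose w : 'rV[int]_k := \row_j (numq (v 0 j) * \prod_(l | l != j) denq (v 0 l)).
have wE : map_mx intr w = d%:~R *: v.
  apply/rowP => j; rewrite !mxE /d [in RHS](bigD1 j) //= !rmorphM /= numqE.
  by rewrite [RHS]mulrC mulrA.
have w0 : w = 0.
  apply: A_free; apply/matrixP => p q; apply: (intr_inj (R := rat)).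
  have := congr1 (fun X : 'M_(_, _) => X p q)
    (map_mxM (intr : {rmorphism int -> rat}) w A).
  by rewrite wE -scalemxAl vA scaler0 !mxE.
have /eqP := wE; rewrite w0 map_mx0 eq_sym scaler_eq0 (negPf d_nz) /=.
by move/eqP.
Qed.

(** The hyperplane is cut out by the linear forms with coefficients (1, ..., 1)
    and c, which are independent over the rationals when c is not constant. *)
Lemma hyperplane_lin_indep (c : 'I_n -> nat) k (A : 'M[int]_(k, n)) i j :
  c i != c j -> lin_indep (hyperplane c) A -> (k + 2 <= n)%N.
Proof.
move=> c_ij [A_in A_free]; have := int_free_rat A_free.
set AQ := map_mx _ _ => /eqP <-.
pose C : 'M[rat]_(n, 1 + 1) := row_mx (const_mx 1) (\col_l (c l)%:R).
have AC : AQ *m C = 0.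
  apply/matrixP => l m; rewrite /C mul_mx_row mxE.
  have /andP[/eqP sum0 /eqP sumc] := A_in l.
  case: (split m) => m'; rewrite !mxE; rewrite -[RHS](rmorph0 (intr : int -> rat)).
    rewrite -sum0 rmorph_sum; apply: eq_bigr => q _.
    by rewrite !mxE mulr1.
  rewrite -sumc rmorph_sum; apply: eq_bigr => q _.
  by rewrite !mxE rmorphMn /= mulr_natr.
suff C_rank : \rank C = 2%N by rewrite -C_rank; exact: mulmx0_rank_max.
rewrite -mxrank_tr; apply/eqP; rewrite -[_ == _]/(row_free _) -kermx_eq0.
apply/eqP/row_matrixP => l; rewrite row0.
have : row l (kermx C^T) *m C^T = 0 by rewrite -row_mul mulmx_ker row0.
move: (row l _) => v vC.
pose x := v 0 (lshift 1 0); pose y := v 0 (rshift 1 0).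
have eqn q : x + y * (c q)%:R = 0.
  have := congr1 (fun M : 'rV_n => M 0 q) vC.
  rewrite !mxE big_split_ord /= !big_ord1.
  by rewrite /C tr_row_mx col_mxEu col_mxEd !mxE mulr1.
have y0 : y = 0.
  have /eqP : y * ((c i)%:R - (c j)%:R) = 0.
    by have := eqn i; have := eqn j; rewrite mulrBr; lra.
  by rewrite mulf_eq0 subr_eq0 eqr_nat (negPf c_ij) orbF => /eqP.
have x0 : x = 0 by have := eqn i; rewrite y0 mul0r addr0.
apply/rowP => m; rewrite [RHS]mxE.
by rewrite -(splitK m); case: (split m) => m' /=; rewrite ord1.
Qed.

Lemma hyperplane_rank c i j : c i != c j ->
  exists2 r, has_rank (hyperplane c) r & (r + 2 <= n)%N.
Proof.
move=> c_ij.
pose P k := `[< exists A : 'M[int]_(k, n), lin_indep (hyperplane c) A >].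
have exP : exists k, P k.
  by exists 0%N; apply/asboolP; exists 0; split=> [[]//|d _]; apply/rowP => -[].
have P_le k : P k -> (k <= n)%N.
  move=> /asboolP[A /(hyperplane_lin_indep c_ij)].
  by apply: leq_trans; exact: leq_addr.
case: (ex_maxnP exP P_le) => r /asboolP[A Aind] r_max.
exists r; last exact: hyperplane_lin_indep c_ij Aind.
by split=> [|k A' A'_ind]; [exists A | apply: r_max; apply/asboolP; exists A'].
Qed.

End Hyperplanes.

(** * Bounds for alternating words *)

Lemma fprod_inlD (A B : zmodType) (a a' : A) :
  fprod_inl (a + a')%R = (fprod_inl a * fprod_inl a')%g :> free_product A B.
Proof.
rewrite -[RHS]/(fprod_mul _ _) fprod_mulE; apply/esym/fprod_piP.
exact: fprod_eq_lD.
Qed.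

Lemma fprod_inrD (A B : zmodType) (b b' : B) :
  fprod_inr (b + b')%R = (fprod_inr b * fprod_inr b')%g :> free_product A B.
Proof.
rewrite -[RHS]/(fprod_mul _ _) fprod_mulE; apply/esym/fprod_piP.
exact: fprod_eq_rD.
Qed.

Section UpperBound.
Local Open Scope ring_scope.
Variables (R : realType) (A B : zmodType) (G : groupType).
Variables (alpha : A -> G) (beta : B -> G).
Hypothesis alphaD : forall a a', alpha (a + a') = (alpha a * alpha a')%g.
Hypothesis betaD : forall b b', beta (b + b') = (beta b * beta b')%g.

Lemma scl_alt_word_le (s : seq (A * B)) n r : size s = n -> (r.*2 + 3 <= n)%N ->
  sumA s = 0 -> sumB s = 0 ->
  scl R (alt_word alpha beta s) <= n%:R / 2 - 1 + 3 / r.+1%:R.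
Proof.
move=> sz_s le_rn sA sB.
(* The exponent 2 (q + 1) (times q + 1 for even n) makes both the constant terms
   and the cost of closing up O(1 / q) after division. *)
pose q := ((n - 3)./2)%N.
apply: (@le_trans _ _ (n%:R / 2 - 1 + 3 / q.+1%:R)); last first.
  by rewrite lerD2l ler_wpM2l // lef_pV2 ?posrE ?ltr0n // ler_nat /q; lia.
have sr := alt_word_comm alphaD betaD sA sB.
have K_gt0 : (0 : R) < q.+1%:R by rewrite ltr0n.
have KK : q.+1%:R = q%:R + 1 :> R by rewrite -natr1.
have [odd_n|even_n] := boolP (odd n).
  have nE : n = (q.*2 + 3)%N by rewrite /q; lia.
  have pw := odd_power alphaD betaD (q.+1).*2 (etrans sz_s nE) sA sB.
  apply: le_trans (scl_le R sr _ pw) _; first by rewrite double_gt0.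
  rewrite nE doubleK -!muln2 !natrD !natrM KK.
  move: K_gt0; rewrite KK => K_gt0; rewrite ler_pdivrMr ?mulr_gt0 //.
  rewrite [leRHS]mulrDl [3 / _ * _]mulrA divfK ?gt_eqF //.
  have : (0 : R) <= q%:R by [].
  nra.
have nE : n = (q.*2 + 4)%N by rewrite /q; lia.
have pw := even_power alphaD betaD (q.+1).*2 (etrans sz_s nE) sA sB.
apply: le_trans (scl_le R sr _ pw) _; first by rewrite muln_gt0 double_gt0.
rewrite nE doubleK -!muln2 !(natrD, natrM) KK.
move: K_gt0; rewrite KK => K_gt0; rewrite ler_pdivrMr ?mulr_gt0 //.
have -> : (q%:R * 2 + 4) / 2 - 1 = q%:R + 1 :> R by lra.
rewrite [leRHS]mulrDl.
have -> : 3 / (q%:R + 1) * ((q%:R + 1) * 2 * (q%:R + 1)) = 6 * (q%:R + 1) :> R.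
  by rewrite -(mulrA (_ + 1)) (mulrA (3 / _)) divfK ?gt_eqF //; lra.
have : (0 : R) <= q%:R by [].
nra.
Qed.
End UpperBound.

Section LowerBound.
Local Open Scope ring_scope.
Variables (R : realType) (A B A' B' : zmodType) (n : nat).
Variables (u : 'I_n -> A) (v : 'I_n -> B) (f : A -> A') (g : B -> B').
Hypothesis fD : {morph f : x y / x + y}.
Hypothesis gD : {morph g : x y / x + y}.
Hypothesis no_short_u : forall s : seq 'I_n,
  (0 < size s < n)%N -> \sum_(j <- s) f (u j) != 0.
Hypothesis no_short_v : forall s : seq 'I_n,
  (0 < size s < n)%N -> \sum_(j <- s) g (v j) != 0.

Let syllables : seq (A * B) := [seq (u j, v j) | j <- enum 'I_n].
Let w := alt_word (@fprod_inl A B) (@fprod_inr A B).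

Definition letters (s : seq (A * B)) : seq (A + B) :=
  flatten [seq [:: inl p.1; inr p.2] | p <- s].

Lemma fprod_pi_letters s : fprod_pi (letters s) = w s.
Proof.
elim: s => [|p s IHs]; first by rewrite /w /alt_word big_nil.
rewrite /w alt_word_cons -/(w s) -IHs.
rewrite -[RHS]/(fprod_mul (fprod_mul (fprod_inl p.1) (fprod_inr p.2))
                          (fprod_pi (letters s))).
by rewrite /fprod_inl /fprod_inr !fprod_mulE.
Qed.

Lemma alt_word_nseq k s : w (flatten (nseq k s)) = (w s ^+ k)%g.
Proof.
elim: k => [|k IHk]; first by rewrite /w /alt_word big_nil.
by rewrite expgS -IHk /w -alt_word_cat.
Qed.

Lemma letters_reduced s : all (fun p => (p.1 != 0) && (p.2 != 0)) s ->
  reduced (letters s).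
Proof.
rewrite /reduced; elim: s => // p s IHs /= /andP[/andP[-> ->] /IHs/andP[-> /=]].
by case: s {IHs}.
Qed.

Definition letter_weight (c : A + B) : R :=
  match c with
  | inl a => sawtooth R (f \o u) (f a)
  | inr b => sawtooth R (g \o v) (g b)
  end.

(** The homomorphisms f and g allow the weights to depend on one coordinate of
    the syllables only. *)
Lemma scl_alt_word_ge : (1 < n)%N -> \sum_j u j = 0 -> \sum_j v j = 0 ->
  n%:R / 2 - 1 <= scl R (w syllables).
Proof.
move=> n_gt1 su sv.
have f0 : f 0 = 0 by apply: (addrI (f 0)); rewrite -fD !addr0.
have g0 : g 0 = 0 by apply: (addrI (g 0)); rewrite -gD !addr0.
have fN a : f (- a) = - f a by apply: (addrI (f a)); rewrite -fD !subrr.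
have gN b : g (- b) = - g b by apply: (addrI (g b)); rewrite -gD !subrr.
have n_gt0 := ltnW n_gt1; have n_gt0R : (0 : R) < n%:R by rewrite ltr0n.
have sr : prod_of_commutators (size syllables) (w syllables).
  apply: alt_word_comm; [exact: fprod_inlD | exact: fprod_inrD | |].
  - by rewrite /sumA big_map big_enum.
  - by rewrite /sumB big_map big_enum.
apply: (scl_ge sr) => k m /qmorph_pcomm qm.
have wtN c : letter_weight (letter_inv c) = - letter_weight c.
  by case: c => [a|b] /=; rewrite ?fN ?gN sawtoothN.
have wt_l a a' : `|letter_weight (inl (a + a')) - letter_weight (inl a)
    - letter_weight (inl a')| <= 2^-1.
  by rewrite /= fD; exact: sawtooth_triangle.
have wt_r b b' : `|letter_weight (inr (b + b')) - letter_weight (inr b)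
    - letter_weight (inr b')| <= 2^-1.
  by rewrite /= gD; exact: sawtooth_triangle.
have {qm} := qm R letter_weight wtN wt_l wt_r.
rewrite -alt_word_nseq -fprod_pi_letters qmorphE reduced_normal_form; last first.
  apply: letters_reduced; apply/allP => p /flattenP[s /nseqP[-> _]] /mapP[j _ ->] /=.
  apply/andP; split.
    apply: contra_neq (no_short_u (s := [:: j]) _) => // uj0.
    by rewrite big_seq1 uj0.
  apply: contra_neq (no_short_v (s := [:: j]) _) => // vj0.
  by rewrite big_seq1 vj0.
have weight_letters s : weight letter_weight (letters s) =
    \sum_(p <- s) (letter_weight (inl p.1) + letter_weight (inr p.2)).
  elim: s => [|p s IHs]; first by rewrite big_nil weight_nil.
  by rewrite big_cons -IHs [letters _]/= !weight_cons addrA.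
rewrite weight_letters => qm.
suff : (n%:R - 2) * k%:R <= \sum_(p <- flatten (nseq k syllables))
    (letter_weight (inl p.1) + letter_weight (inr p.2)) by move: qm; lra.
elim: (k) => [|k' IHk]; first by rewrite mulr0 big_nil.
rewrite /= big_cat /= (mulrSr 1 k') mulrDr mulr1 addrC lerD //.
rewrite big_map big_enum /=.
have -> : n%:R - 2 = \sum_(j < n) ((2^-1 - n%:R^-1) + (2^-1 - n%:R^-1)) :> R.
  rewrite sumr_const card_ord -mulr_natr.
  have : n%:R^-1 * n%:R = 1 :> R by rewrite mulVf ?gt_eqF.
  by lra.
apply: ler_sum => j _; apply: lerD.
  exact: (sawtooth_gen R (u := f \o u)).
exact: (sawtooth_gen R (u := g \o v)).
Qed.

End LowerBound.

(** * Generic words *)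

Section GenericWords.
Local Open Scope ring_scope.
Variable n : nat.
Implicit Types (x y z : finseq n) (i : nat) (j : 'I_n).

Lemma coeff_syllable z i j : coeff i (syllable z j) = z i 0 j.
Proof.
rewrite /syllable raddf_sum /=.
under eq_bigr => k _ do rewrite coeffU.
have [i_in|i_out] := boolP (i \in finsupp z).
  rewrite (bigD1_seq i) ?fset_uniq //= eqxx mulr1 big1 ?addr0 // => k /negPf ->.
  by rewrite mulr0.
rewrite big_seq big1 => [|k k_in]; first by rewrite fsfun_dflt // mxE.
by case: eqP k_in i_out => [-> ->|]; rewrite ?mulr0.
Qed.

Lemma sum_syllable z : (forall i, z i \in V n) -> \sum_j syllable z j = 0.
Proof.
move=> zV; apply/eqP/freeg_eqP => i /=; rewrite raddf_sum coeff0 /=.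
under eq_bigr => j _ do rewrite coeff_syllable.
exact/eqP/zV.
Qed.

Lemma phiE x y : phi x y = alt_word (@fprod_inl Zinf Zinf) (@fprod_inr Zinf Zinf)
  [seq (syllable x j, syllable y j) | j <- enum 'I_n].
Proof. by rewrite /alt_word big_map enumT /phi [index_enum _]unlock. Qed.

(** The multiplicities of a sum of fewer than n terms, constant ones excluded:
    the constant relation holds on all of V. *)
Definition relation : finType :=
  {c : {ffun 'I_n -> 'I_n} | ~~ [forall i, forall j, c i == c j]}.

Definition relation_plane (k : 'I_#|relation|) : {pred 'rV[int]_n} :=
  hyperplane (fun j => val (enum_val k) j).

Lemma relation_plane_submodule k : submodule (relation_plane k) /\
  exists2 r, has_rank (relation_plane k) r & (r + 2 <= n)%N.
Proof.
split; first exact: hyperplane_submodule.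
have /forallPn[i /forallPn[j c_ij]] := valP (enum_val k).
by apply: (@hyperplane_rank _ _ i j); rewrite val_eqE.
Qed.

Lemma sum_count (W : nmodType) (F : 'I_n -> W) (s : seq 'I_n) :
  \sum_(j <- s) F j = \sum_j F j *+ count_mem j s.
Proof.
elim: s => [|i s IHs]; first by rewrite big_nil big1.
rewrite big_cons IHs /=; under [RHS]eq_bigr => j _ do rewrite mulrnDr.
rewrite big_split [in RHS](bigD1 i) //=; congr (_ + _).
by rewrite eqxx mulr1n big1 ?addr0 // => j /negPf; rewrite eq_sym => ->.
Qed.

Lemma no_short_relation (z : 'rV[int]_n) :
  z \in V n -> (forall k, z \notin relation_plane k) ->
  forall s : seq 'I_n, (0 < size s < n)%N -> \sum_(j <- s) z 0 j != 0.
Proof.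
move=> zV z_out s /andP[s_gt0 lt_sn]; apply/eqP => zs.
have cnt_lt j : (count_mem j s < n)%N by apply: leq_ltn_trans (count_size _ _) lt_sn.
pose c := [ffun j => Ordinal (cnt_lt j)].
(* Constant multiplicities would make the length of s a multiple of n. *)
have c_var : ~~ [forall i, forall j, c i == c j].
  apply/negP => /forallP c_const.
  have [i _] : exists i : 'I_n, True by exists (Ordinal lt_sn).
  have : size s = (count_mem i s * n)%N.
    have := sum_count (fun=> 1%N) s; rewrite sum1_size => ->.
    transitivity (\sum_(j < n) count_mem i s)%N; last first.
      by rewrite sum_nat_const card_ord mulnC.
    apply: eq_bigr => j _; rewrite natn.
    have /forallP/(_ i)/eqP/(congr1 val) := c_const j.
    by rewrite !ffunE.
  by case: (count_mem i s) => [|k]; lia.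
pose k : 'I_#|relation| := enum_rank (exist _ c c_var).
have /negP := z_out k; apply; rewrite /relation_plane enum_rankK inE zV /=.
apply/eqP; rewrite -[RHS]zs [RHS]sum_count; apply: eq_bigr => j _.
by rewrite ffunE.
Qed.

End GenericWords.

Local Open Scope ring_scope.

Theorem mainTheorem4 (R : realType) (eps : R) :
  0 < eps ->
  exists N : nat, forall m n : nat, (1 <= n)%N -> m = (2 * n)%N -> (N <= m)%N ->
    generically n (fun w : Zinf2 =>
      scl R w \in `[m%:R / 4 - 1, m%:R / 4 - 1 + eps]).
Proof.
move=> eps_gt0; pose r := Num.truncn (3 / eps).
exists (4 * r + 8)%N => m n n_gt0 mE le_m.
exists #|relation n|, (@relation_plane n).
split; first exact: relation_plane_submodule.
move=> x y [xV _] [yV _] x_gen y_gen.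
have gen (z : finseq n) : (forall i, z i \in V n) ->
    ~ (forall i, exists k, z i \in relation_plane k) ->
    exists i, forall s : seq 'I_n, (0 < size s < n)%N ->
      \sum_(j <- s) coeff i (syllable z j) != 0.
  move=> zV /existsNP[i /forallNP z_out]; exists i => s s_size.
  under eq_bigr => j _ do rewrite coeff_syllable.
  by apply: no_short_relation s_size => // k; apply/negP.
have [i x_free] := gen x xV x_gen; have [i' y_free] := gen y yV y_gen.
have sx := sum_syllable xV; have sy := sum_syllable yV.
have -> : m%:R / 4 - 1 = n%:R / 2 - 1 :> R by rewrite mE natrM; lra.
rewrite phiE in_itv /=; apply/andP; split.
  by apply: (scl_alt_word_ge _ (coeffD i) (coeffD i') x_free y_free) => //; lia.
apply: (@le_trans _ _ (n%:R / 2 - 1 + 3 / r.+1%:R)).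
  apply: scl_alt_word_le; [exact: fprod_inlD | exact: fprod_inrD | | | |].
  - by rewrite size_map size_enum_ord.
  - by lia.
  - by rewrite /sumA big_map big_enum.
  - by rewrite /sumB big_map big_enum.
rewrite lerD2l ler_pdivrMr ?ltr0n // mulrC -ler_pdivrMr //.
by apply: ltW; exact: truncnS_gt.
Qed.
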